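(* A ring $R$ is an $EM$-ring if and only if the idealization $H=R(+)R$ is an $EM$-$\mathbb{Z}_2$-graded ring with gradation $H_0=R\oplus 0$ and $H_1=0\oplus R$.
   Context: All rings are commutative with $1$. For a ring $A$, $Z(A)$ is the set of zero divisors of $A$ ($0$ included) and $reg(A)$ is the set of regular elements (non-zero-divisors). A zero divisor polynomial $f\in A[x]$ has an annihilating content if there are $c_f\in Z(A)$ and $f_1\in reg(A[x])$ with $f=c_ff_1$. $A$ is an $EM$-ring if every zero divisor polynomial in $A[x]$ has an annihilating content. For an $R$-module $M$, the idealization $R(+)M$ is the ring on $R\times M$ with $(r_1,m_1)+(r_2,m_2)=(r_1+r_2,m_1+m_2)$ and $(r_1,m_1)(r_2,m_2)=(r_1r_2,r_1m_2+r_2m_1)$; it is $\mathbb{Z}_2$-graded with degree $0$ component $R\oplus 0$ and degree $1$ component $0\oplus M$. For a group $G$ and a $G$-graded ring $A=\oplus_{\sigma\in G}A_\sigma$, $A[x]$ is $G$-graded by $(A[x])_\sigma=A_\sigma[x]$; so a polynomial is homogeneous iff all its coefficients lie in a single $A_\sigma$. $A$ is an $EM$-$G$-graded ring if every nonzero homogeneous zero divisor polynomial in $A[x]$ has an annihilating content (with $c_f\in Z(A)$ and $f_1\in reg(A[x])$, neither required to be homogeneous). *)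

(* Defs.v *)
From HB Require Import structures.
From mathcomp Require Import all_boot all_order all_algebra all_fingroup.

Set Implicit Arguments.
Unset Strict Implicit.
Unset Printing Implicit Defensive.

Import GRing.Theory.
Local Open Scope ring_scope.

Definition zero_divisor (A : comNzRingType) (a : A) : Prop :=
  exists2 b : A, b != 0 & a * b = 0.

Definition regular (A : comNzRingType) (a : A) : Prop := ~ zero_divisor a.

Lemma zero_divisor0 (A : comNzRingType) : zero_divisor (0 : A).
Proof. by exists 1; rewrite ?oner_neq0 ?mul0r. Qed.

Lemma regularP (A : comNzRingType) (a : A) : regular a <-> GRing.lreg a.
Proof.
split=> [reg_a | reg_a [b b_neq0 ab0]].
  apply: GRing.mulrI0_lreg => b ab0; apply/eqP.
  by case: (eqVneq b 0) => // b_neq0; case: reg_a; exists b.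
by case/eqP: b_neq0; apply: reg_a; rewrite mulr0.
Qed.

Definition has_annihilating_content (A : comNzRingType) (f : {poly A}) : Prop :=
  exists (c : A) (f1 : {poly A}),
    [/\ zero_divisor c, regular f1 & f = c *: f1].

Definition EM_ring (A : comNzRingType) : Prop :=
  forall f : {poly A}, zero_divisor f -> has_annihilating_content f.

(* A = (+)_s A_s as a direct sum of additive subgroups with A_s A_t <= A_st.
   The group law is multiplicative; on 'Z_n it is addition modulo n. *)
Record gradation (G : groupType) (A : comNzRingType) := Gradation {
  gcomp : G -> zmodClosed A;
  gcompM : forall s t (a b : A),
    a \in gcomp s -> b \in gcomp t -> a * b \in gcomp (s * t)%g;
  gcomp_span : forall a : A, exists2 r : seq A,
    (forall b, b \in r -> exists s, b \in gcomp s) & a = \sum_(b <- r) b;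
  gcomp_direct : forall (r : seq G) (F : G -> A), uniq r ->
    (forall s, s \in r -> F s \in gcomp s) ->
    \sum_(s <- r) F s = 0 -> forall s, s \in r -> F s = 0
}.

Definition homogeneous (G : groupType) (A : comNzRingType)
  (gr : gradation G A) (a : A) : Prop := exists s : G, a \in gcomp gr s.

Section PolyGradation.
Variables (G : groupType) (A : comNzRingType) (gr : gradation G A).

Definition poly_gcomp (s : G) : zmodClosed {poly A} :=
  GRing.ZmodClosed.clone {poly A} (polyOver_pred (gcomp gr s)) _.

Lemma poly_gcompE s f :
  (f \in poly_gcomp s) = (f \is a polyOver (gcomp gr s)).
Proof. by []. Qed.

Lemma poly_gcompM s t (f g : {poly A}) :
  f \in poly_gcomp s -> g \in poly_gcomp t -> f * g \in poly_gcomp (s * t)%g.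
Proof.
move=> /polyOverP fs /polyOverP gt; apply/polyOverP => i.
by rewrite coefM; apply: rpred_sum => j _; apply: gcompM.
Qed.

Lemma poly_gcomp_span (f : {poly A}) : exists2 r : seq {poly A},
  (forall g, g \in r -> exists s, g \in poly_gcomp s) & f = \sum_(g <- r) g.
Proof.
elim/poly_ind: f => [|f c [r r_hom ->]].
  by exists [::] => [//|]; rewrite big_nil.
have [q q_hom ->] := gcomp_span gr c.
exists ([seq g * 'X | g <- r] ++ [seq b%:P | b <- q]).
  move=> g; rewrite mem_cat => /orP[] /mapP[h h_in ->].
    have [s /polyOverP hs] := r_hom h h_in; exists s; apply/polyOverP => i.
    by rewrite coefMX; case: eqP; rewrite ?rpred0.
  have [s hs] := q_hom h h_in; exists s; apply/polyOverP => i.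
  by rewrite coefC; case: eqP; rewrite ?rpred0.
by rewrite big_cat /= !big_map -mulr_suml (raddf_sum (@polyC A)).
Qed.

Lemma poly_gcomp_direct (r : seq G) (F : G -> {poly A}) : uniq r ->
  (forall s, s \in r -> F s \in poly_gcomp s) ->
  \sum_(s <- r) F s = 0 -> forall s, s \in r -> F s = 0.
Proof.
move=> r_uniq F_hom F0 s s_r; apply/polyP => i; rewrite coef0.
apply: (gcomp_direct (g := gr) (F := fun s => (F s)`_i) r_uniq _ _ s_r).
  by move=> t /F_hom /polyOverP.
by rewrite -coef_sum F0 coef0.
Qed.

Definition poly_gradation : gradation G {poly A} :=
  Gradation poly_gcompM poly_gcomp_span poly_gcomp_direct.

End PolyGradation.

Definition EM_graded_ring (G : groupType) (A : comNzRingType)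
    (gr : gradation G A) : Prop :=
  forall f : {poly A}, f != 0 -> homogeneous (poly_gradation gr) f ->
    zero_divisor f -> has_annihilating_content f.

(* The alias keeps the idealization product apart from the componentwise
   product that R * M carries when M is itself a ring. *)
Definition idealization (R : comNzRingType) (M : lmodType R) : Type :=
  (R * M)%type.

Section Idealization.
Variables (R : comNzRingType) (M : lmodType R).
Local Notation H := (idealization M).
Implicit Types x y z : H.

HB.instance Definition _ := GRing.Zmodule.copy H (R * M)%type.

Definition idz_one : H := (1, 0).
Definition idz_mul x y : H := (x.1 * y.1, x.1 *: y.2 + y.1 *: x.2).

Fact idz_mulA : associative idz_mul.
Proof.
move=> x y z; congr pair; rewrite /= ?mulrA // !scalerDr !scalerA addrA.
by rewrite (mulrC z.1 x.1) (mulrC z.1 y.1).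
Qed.

Fact idz_mulC : commutative idz_mul.
Proof. by move=> x y; congr pair; rewrite /= (mulrC, addrC). Qed.

Fact idz_mul1 : left_id idz_one idz_mul.
Proof. by case=> r m; rewrite /idz_mul /= mul1r scale1r scaler0 addr0. Qed.

Fact idz_mulDl : left_distributive idz_mul +%R.
Proof.
move=> x y z; congr pair; rewrite /= ?mulrDl // scalerDl scalerDr.
by rewrite addrACA.
Qed.

Fact idz_one_neq0 : idz_one != 0 :> H.
Proof. by apply/eqP => -[/eqP]; rewrite oner_eq0. Qed.

HB.instance Definition _ := GRing.Zmodule_isComNzRing.Build H
  idz_mulA idz_mulC idz_mul1 idz_mulDl idz_one_neq0.

Definition idz_deg0 : {pred H} := [pred x : H | x.2 == 0].
Definition idz_deg1 : {pred H} := [pred x : H | x.1 == 0].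

Fact idz_deg0_closed : zmod_closed idz_deg0.
Proof.
by split=> [|x y]; rewrite !inE //= => /eqP-> /eqP->; rewrite subrr.
Qed.

Fact idz_deg1_closed : zmod_closed idz_deg1.
Proof.
by split=> [|x y]; rewrite !inE //= => /eqP-> /eqP->; rewrite subrr.
Qed.

HB.instance Definition _ := GRing.isZmodClosed.Build H idz_deg0
  idz_deg0_closed.
HB.instance Definition _ := GRing.isZmodClosed.Build H idz_deg1
  idz_deg1_closed.

Definition idz_gcomp (s : 'Z_2) : zmodClosed H :=
  if s == 0 then idz_deg0 : zmodClosed H else idz_deg1 : zmodClosed H.

Fact idz_gcompE s x :
  (x \in idz_gcomp s) = (if s == 0 then x.2 == 0 else x.1 == 0).
Proof. by rewrite /idz_gcomp; case: ifP. Qed.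

Fact idz_gcompM s t x y :
  x \in idz_gcomp s -> y \in idz_gcomp t -> x * y \in idz_gcomp (s * t)%g.
Proof.
rewrite !idz_gcompE.
case: s t => [[|[|//]] ?] [[|[|//]] ?] //= /eqP x0 /eqP y0; apply/eqP;
  by rewrite /= ?x0 ?y0 ?(mulr0, mul0r, scaler0, scale0r, addr0).
Qed.

Fact idz_gcomp_span x : exists2 r : seq H,
  (forall y, y \in r -> exists s, y \in idz_gcomp s) & x = \sum_(y <- r) y.
Proof.
exists [:: (x.1, 0) : H; (0, x.2) : H]; last first.
  by rewrite !big_cons big_nil addr0; case: x => r m; congr pair;
     rewrite /= ?addr0 ?add0r.
move=> y; rewrite !inE => /orP[] /eqP->.
  by exists 0; rewrite idz_gcompE /=.
by exists 1; rewrite idz_gcompE /=.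
Qed.

Fact idz_gcomp_direct (r : seq 'Z_2) (F : 'Z_2 -> H) : uniq r ->
  (forall s, s \in r -> F s \in idz_gcomp s) ->
  \sum_(s <- r) F s = 0 -> forall s, s \in r -> F s = 0.
Proof.
move=> r_uniq F_hom F0 s s_r.
have sum1 (q : seq 'Z_2) : (\sum_(t <- q) F t).1 = \sum_(t <- q) (F t).1.
  by elim: q => [|t q IHq]; rewrite ?big_nil // !big_cons -IHq.
have sum2 (q : seq 'Z_2) : (\sum_(t <- q) F t).2 = \sum_(t <- q) (F t).2.
  by elim: q => [|t q IHq]; rewrite ?big_nil // !big_cons -IHq.
have Z2P (t u : 'Z_2) : (t == 0) = (u == 0) -> t = u.
  by case: t u => [[|[|//]] ?] [[|[|//]] ?] // _; apply: val_inj.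
have := F_hom s s_r; rewrite idz_gcompE.
have := sum1 r; have := sum2 r; rewrite F0 !(bigD1_seq s) //=.
case: (eqVneq s 0) => s0 + + /eqP Fs0.
- move=> _; rewrite big1_seq ?addr0 => [Fs1|t /andP[ts /F_hom]].
    by case: (F s) Fs0 Fs1 => ? ? /= -> <-.
  rewrite idz_gcompE; case: eqP => [t0|_ /eqP //].
  by case/eqP: ts; rewrite t0 s0.
- rewrite big1_seq ?addr0 => [Fs2 _|t /andP[ts /F_hom]].
    by case: (F s) Fs0 Fs2 => ? ? /= -> <-.
  rewrite idz_gcompE; case: eqP => [_ /eqP //|/eqP t0].
  by case/eqP: ts; apply: Z2P; rewrite (negPf t0) (negPf s0).
Qed.

Definition idealization_gradation : gradation 'Z_2 H :=
  Gradation idz_gcompM idz_gcomp_span idz_gcomp_direct.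

End Idealization.

Arguments idealization R M : clear implicits.
Arguments idealization_gradation R M : clear implicits.

(* Main.v *)
(** Write H = R(+)R and let [idz_fst] be the projection of H onto R, with kernel
    0(+)R. An element of H, or of H[x], is a zero divisor exactly when its
    projection is one. Hence projecting a factorization of the degree 0
    polynomial (p, 0) yields one of p, and conversely p = c p1 lifts to
    (p, 0) = (c, 0)(p1, 0). Every degree 1 polynomial (0, q) is a zero divisor:
    if q = c q1 with q1 regular then (0, q) = (0, c)(q1, 0), where c need not be
    a zero divisor, so that c = 1 serves when q itself is regular. *)
Require Import Defs.
From HB Require Import structures.
From mathcomp Require Import all_boot all_algebra.
From Stdlib Require Import Classical.
Set Implicit Arguments.
Unset Strict Implicit.
Unset Printing Implicit Defensive.
Import GRing.Theory.
Local Open Scope ring_scope.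

Section SelfIdealization.
Variable R : comNzRingType.
Local Notation H := (idealization R R^o).

(** Named functions on H, so that they can carry morphism structures for the idealization product:
    [idz_fst] and [idz_inj0] are ring morphisms, [idz_snd] and [idz_inj1] are declared additive
    only. *)
Definition idz_fst (x : H) : R := x.1.
Definition idz_snd (x : H) : R := x.2.
Definition idz_inj0 (r : R) : H := (r, 0).
Definition idz_inj1 (r : R) : H := (0, r).

Fact idz_fst_additive : zmod_morphism idz_fst. Proof. by []. Qed.
Fact idz_snd_additive : zmod_morphism idz_snd. Proof. by []. Qed.
Fact idz_inj0_additive : zmod_morphism idz_inj0.
Proof. by move=> r s; congr pair; rewrite /= subr0. Qed.
Fact idz_inj1_additive : zmod_morphism idz_inj1.
Proof. by move=> r s; congr pair; rewrite /= subr0. Qed.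
Fact idz_fst_multiplicative : monoid_morphism idz_fst. Proof. by []. Qed.
Fact idz_inj0_multiplicative : monoid_morphism idz_inj0.
Proof. by split=> // r s; congr pair; rewrite /= !scaler0 addr0. Qed.

HB.instance Definition _ :=
  GRing.isZmodMorphism.Build H R idz_fst idz_fst_additive.
HB.instance Definition _ :=
  GRing.isZmodMorphism.Build H R idz_snd idz_snd_additive.
HB.instance Definition _ :=
  GRing.isZmodMorphism.Build R H idz_inj0 idz_inj0_additive.
HB.instance Definition _ :=
  GRing.isZmodMorphism.Build R H idz_inj1 idz_inj1_additive.
HB.instance Definition _ :=
  GRing.isMonoidMorphism.Build H R idz_fst idz_fst_multiplicative.
HB.instance Definition _ :=
  GRing.isMonoidMorphism.Build R H idz_inj0 idz_inj0_multiplicative.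

(** The ideal 0(+)R squares to zero, so H acts on it through [idz_fst]. *)
Lemma mul_idz_inj1 (x : H) (r : R) : x * idz_inj1 r = idz_inj1 (idz_fst x * r).
Proof. by congr pair; rewrite /= ?mulr0 // scale0r addr0. Qed.

Lemma idz_eta1 (x : H) : idz_fst x = 0 -> x = idz_inj1 (idz_snd x).
Proof. by case: x => r m /= ->. Qed.

(** An annihilator r of the projection lifts to (0, r). Conversely, an annihilator of c either has a
    nonzero projection, which serves, or has the form (0, m), and then m serves. *)
Lemma zero_divisor_idz (c : H) : zero_divisor c <-> zero_divisor (idz_fst c).
Proof.
split=> [[b b_neq0 cb0] | [b b_neq0 cb0]]; last first.
  exists (idz_inj1 b); last by rewrite mul_idz_inj1 cb0 raddf0.
  by apply: contra_neq b_neq0 => -[].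
have cb0_1 : idz_fst c * idz_fst b = 0 by rewrite -rmorphM cb0 rmorph0.
case: (eqVneq (idz_fst b) 0) => [b1_0 | b1_neq0]; last by exists (idz_fst b).
exists (idz_snd b); first by apply: contra_neq b_neq0 => b2_0;
  rewrite (idz_eta1 b1_0) b2_0 raddf0.
by move: cb0; rewrite (idz_eta1 b1_0) mul_idz_inj1 => -[].
Qed.

Local Notation "f ^1" := (map_poly idz_fst f) (at level 2).
Local Notation in0 := (map_poly idz_inj0).
Local Notation in1 := (map_poly idz_inj1).

Lemma mul_map_idz_inj1 (f : {poly H}) (q : {poly R}) : f * in1 q = in1 (f^1 * q).
Proof.
apply/polyP => i; rewrite coefM coef_map coefM raddf_sum.
by apply: eq_bigr => j _; rewrite !coef_map mul_idz_inj1.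
Qed.

Lemma map_idz_eta1 (f : {poly H}) : f^1 = 0 -> f = in1 (map_poly idz_snd f).
Proof.
move=> f1_0; apply/polyP => i; rewrite !coef_map; apply: idz_eta1.
by rewrite -coef_map f1_0 coef0.
Qed.

Lemma map_idz_inj1_eq0 (q : {poly R}) : in1 q = 0 -> q = 0.
Proof.
move=> /polyP q0; apply/polyP => i.
by have := q0 i; rewrite coef_map !coef0 => -[].
Qed.

Lemma map_idz_inj0K (p : {poly R}) : (in0 p)^1 = p.
Proof. by apply/polyP => i; rewrite !coef_map. Qed.

(** The argument for elements of H carries over, since H[x] is R[x](+)R[x] up to isomorphism. *)
Lemma zero_divisor_map_idz (f : {poly H}) :
  zero_divisor f <-> zero_divisor f^1.
Proof.
split=> [[g g_neq0 fg0] | [q q_neq0 fq0]]; last first.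
  exists (in1 q); last by rewrite mul_map_idz_inj1 fq0 raddf0.
  by apply: contra_neq q_neq0 => /map_idz_inj1_eq0.
have fg0_1 : f^1 * g^1 = 0 by rewrite -rmorphM fg0 rmorph0.
case: (eqVneq g^1 0) => [g1_0 | g1_neq0]; last by exists g^1.
exists (map_poly idz_snd g); first by apply: contra_neq g_neq0 => g2_0;
  rewrite (map_idz_eta1 g1_0) g2_0 raddf0.
by apply: map_idz_inj1_eq0; rewrite -mul_map_idz_inj1 -map_idz_eta1.
Qed.

Lemma regular_map_idz_inj0 (p : {poly R}) : regular p -> regular (in0 p).
Proof. by move=> reg_p /zero_divisor_map_idz; rewrite map_idz_inj0K. Qed.

Lemma homogeneous_idz_poly (f : {poly H}) :
  homogeneous (poly_gradation (idealization_gradation R R^o)) f <->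
  (exists p, f = in0 p) \/ (exists q, f = in1 q).
Proof.
split=> [[s /polyOverP f_s] | [[p ->] | [q ->]]].
(* Degree s = 0 kills all second components, the other degree all first ones. *)
- have {}f_s i : if s == 0 then idz_snd f`_i == 0 else idz_fst f`_i == 0.
    by have := f_s i; rewrite idz_gcompE.
  case: (s == 0) f_s => f_s; [left | right].
    exists f^1; apply/polyP => i; rewrite !coef_map /=.
    by case: f`_i (eqP (f_s i)) => r m /= ->.
  exists (map_poly idz_snd f); apply: map_idz_eta1.
  by apply/polyP => i; rewrite coef_map coef0; apply/eqP/f_s.
- by exists 0; apply/polyOverP => i; rewrite coef_map idz_gcompE /=.
- by exists 1; apply/polyOverP => i; rewrite coef_map idz_gcompE /=.
Qed.

Lemma annihilating_content_idz_fst (f : {poly H}) :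
  has_annihilating_content f -> has_annihilating_content f^1.
Proof.
move=> [c [f1 [zd_c reg_f1 ->]]]; exists (idz_fst c), f1^1.
split; first exact/zero_divisor_idz; last exact: map_polyZ.
by move=> /zero_divisor_map_idz.
Qed.

Lemma annihilating_content_idz_inj0 (p : {poly R}) :
  has_annihilating_content p -> has_annihilating_content (in0 p).
Proof.
move=> [c [p1 [zd_c reg_p1 ->]]]; exists (idz_inj0 c), (in0 p1).
split; [exact/zero_divisor_idz | exact: regular_map_idz_inj0 | exact: map_polyZ].
Qed.

Lemma annihilating_content_idz_inj1 (c : R) (q : {poly R}) :
  regular q -> has_annihilating_content (in1 (c *: q)).
Proof.
move=> reg_q; exists (idz_inj1 c), (in0 q); split.
(* The projection of (0, c) is 0, whatever c is. *)
- by apply/zero_divisor_idz; apply: zero_divisor0.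
- exact: regular_map_idz_inj0.
apply/polyP => i; rewrite coefZ !coef_map coefZ /=.
by rewrite [RHS]mulrC mul_idz_inj1 mulrC.
Qed.

End SelfIdealization.

Theorem corollary3p24 (R : comNzRingType) :
  EM_ring R <-> EM_graded_ring (idealization_gradation R R^o).
Proof.
split=> [EM_R f _ /homogeneous_idz_poly[[p ->] | [q ->]] | EM_H p zd_p].
- rewrite zero_divisor_map_idz map_idz_inj0K => /EM_R.
  exact: annihilating_content_idz_inj0.
(* Regularity is the negation of being a zero divisor, so excluded middle gives the two cases. *)
- move=> _; have [/EM_R[c [q1 [_ reg_q1 ->]]] | reg_q] := classic (zero_divisor q).
    exact: annihilating_content_idz_inj1.
  by rewrite -[q]scale1r; apply: annihilating_content_idz_inj1.
(* The graded condition speaks of nonzero polynomials only; p = 0 is settled by 0 = 0 * 1. *)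
rewrite -[p]map_idz_inj0K; have [-> | p_neq0] := eqVneq p 0.
  exists 0, 1; rewrite !rmorph0 scale0r; split=> //; first exact: zero_divisor0.
  by move=> [b b_neq0]; rewrite mul1r; apply/eqP.
apply/annihilating_content_idz_fst/EM_H.
- by apply: contra_neq p_neq0 => p0; rewrite -[p]map_idz_inj0K p0 rmorph0.
- by apply/homogeneous_idz_poly; left; exists p.
- by apply/zero_divisor_map_idz; rewrite map_idz_inj0K.
Qed.
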